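(* Let $1<p<2<q<\infty$ be such that $$\frac1p\ <\ \frac1q\log_2\binom{q}{q/2}.$$ Then: (i) There exist an integer $d\ge1$ and matrices $G_\omega=\begin{pmatrix}A_\omega&B_\omega\\ \overline{B_\omega}&\overline{A_\omega}\end{pmatrix}\in\mathrm{SU}(1,1)$, $\omega\in\{0,1\}^d$, such that, with $a_\emptyset^{(d)}$ the upper-left entry of the associated root matrix $P_\emptyset^{(d)}$, the inequality $$\left\|\bigl(\log|a_\emptyset^{(d)}|^2\bigr)^{1/2}\right\|_{L^q(\mathbb{T}^d)}\le\left(\sum_{\omega\in\{0,1\}^d}\bigl(\log|A_\omega|^2\bigr)^{p/2}\right)^{1/p}$$ fails. (ii) Already for two factors, there exist $G_j=\begin{pmatrix}A_j&B_j\\ \overline{B_j}&\overline{A_j}\end{pmatrix}\in\mathrm{SU}(1,1)$, $j=0,1$, such that, with $a_1(t)$ the upper-left entry of $G_0D(t)G_1D(t)^{-1}$, the inequality $$\left\|\bigl(\log|a_1|^2\bigr)^{1/2}\right\|_{L^q(\mathbb{T})}\le\left(\bigl(\log|A_0|^2\bigr)^{p/2}+\bigl(\log|A_1|^2\bigr)^{p/2}\right)^{1/p}$$ fails.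
   Context: $\mathbb{T}=\mathbb{R}/\mathbb{Z}$ with normalized Haar measure, $\mathbb{T}^d$ with the product measure; $\log$ is the natural logarithm. For real $q>2$, $\binom{q}{q/2}:=\Gamma(q+1)/\Gamma(q/2+1)^2$. $\mathrm{SU}(1,1)$ is the group of complex matrices $\begin{pmatrix}A&B\\ \overline{B}&\overline{A}\end{pmatrix}$ with $|A|^2-|B|^2=1$. For $s\in\mathbb{R}$, $D(s):=\begin{pmatrix}e^{\pi i s}&0\\0&e^{-\pi i s}\end{pmatrix}$; conjugation $D(s)GD(s)^{-1}$ depends only on $s$ modulo $1$. For words $\sigma,\tau$ over $\{0,1\}$, $\sigma\tau$ is their concatenation, and $\{0,1\}^0=\{\emptyset\}$ with $\emptyset$ the empty word. Given $(G_\omega)_{\omega\in\{0,1\}^d}$ in $\mathrm{SU}(1,1)$, the root matrix $P_\emptyset^{(d)}(t_1,\dots,t_d)$ is obtained by setting $P_\omega^{(0)}:=G_\omega$ for $\omega\in\{0,1\}^d$ and, for $1\le n\le d$, $\sigma\in\{0,1\}^{d-n}$, $$P_\sigma^{(n)}(t_1,\dots,t_n):=P_{\sigma0}^{(n-1)}(t_1,\dots,t_{n-1})\,D(t_n)\,P_{\sigma1}^{(n-1)}(t_1,\dots,t_{n-1})\,D(t_n)^{-1}.$$ *)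

(* Defs.v *)
From HB Require Import structures.
From mathcomp Require Import all_boot all_order all_algebra.
From mathcomp Require Import all_classical all_reals all_analysis.
From mathcomp Require Import complex.

Set Implicit Arguments.
Unset Strict Implicit.
Unset Printing Implicit Defensive.

Import Order.TTheory GRing.Theory Num.Theory.
Import ComplexField.

Local Open Scope classical_set_scope.
Local Open Scope ring_scope.
Local Open Scope complex_scope.

(* Euler's integral, which converges for x > 0 only; elsewhere the value is
   junk. *)
Definition Gamma (R : realType) (x : R) : R :=
  (\int[@lebesgue_measure R]_(t in `]0%R, +oo[) (t `^ (x - 1) * expR (- t)))%R.

(* The binomial coefficient q over q/2 for real q. *)
Definition central_binom (R : realType) (q : R) : R :=
  Gamma (q + 1) / Gamma (q / 2 + 1) ^+ 2.

Definition log2 (R : realType) (x : R) : R := ln x / ln 2.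

Definition mx22 (R : realType) (a b c d : R[i]) : 'M[R[i]]_2 :=
  \matrix_(i, j) (if i == ord0 then if j == ord0 then a else b
                  else if j == ord0 then c else d).

(* Normc.normc is the R-valued modulus; the generic norm of R[i] takes its
   values in R[i]. *)
Definition SU11 (R : realType) : set 'M[R[i]]_2 :=
  [set G | exists A B : R[i],
     G = mx22 A B B^* A^* /\ Normc.normc A ^+ 2 - Normc.normc B ^+ 2 = 1].

(* exp(i theta) *)
Definition expi (R : realType) (theta : R) : R[i] := cos theta +i* sin theta.

Definition Dmx (R : realType) (s : R) : 'M[R[i]]_2 :=
  mx22 (expi (pi * s)) 0 0 (expi (- (pi * s))).

Definition conjD (R : realType) (s : R) (G : 'M[R[i]]_2) : 'M[R[i]]_2 :=
  Dmx s *m G *m invmx (Dmx s).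

Lemma DmxD1 (R : realType) (s : R) : Dmx (s + 1) = - Dmx s.
Proof.
apply/matrixP => i j; rewrite !mxE /expi mulrDr mulr1 !cosN !sinN.
rewrite cosDpi sinDpi.
by case: ifP => _; case: ifP => _; rewrite ?oppr0.
Qed.

(* Conjugation by D(s) descends to the circle R/Z. *)
Lemma conjD_periodic (R : realType) (s : R) (G : 'M[R[i]]_2) :
  conjD (s + 1) G = conjD s G.
Proof.
rewrite /conjD DmxD1.
have -> : invmx (- Dmx s) = - invmx (Dmx s).
  exact: (invrN (Dmx s : 'M[R[i]]_1.+1)).
by rewrite !mulNmx mulmxN opprK.
Qed.

(* The matrix P_sigma^(n)(t_1, ..., t_n), with t_k stored at index k - 1 of t.
   In a tree of depth d it is meant for words sigma of length d - n, and then
   G is only evaluated at words of length d. *)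
Fixpoint treemx (R : realType) (G : seq bool -> 'M[R[i]]_2) (t : seq R)
    (n : nat) (sigma : seq bool) : 'M[R[i]]_2 :=
  if n is m.+1 then
    treemx G t m (rcons sigma false) *m
    conjD (nth 0 t m) (treemx G t m (rcons sigma true))
  else G sigma.

Definition rootmx (R : realType) (d : nat) (G : seq bool -> 'M[R[i]]_2)
    (t : d.-tuple R) : 'M[R[i]]_2 :=
  treemx G t d [::].

(* Functions on the circle R/Z are represented by 1-periodic functions on R,
   and Haar measure by Lebesgue measure on the period [0, 1]. *)
Definition haar_circle (R : realType) : probability (measurableTypeR R) R :=
  uniform_prob (@ltr01 R).

Definition tcons (R : realType) (n : nat)
    (x : measurableTypeR R * n.-tuple (measurableTypeR R)) :
    n.+1.-tuple (measurableTypeR R) :=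
  [tuple of x.1 :: x.2].

Lemma measurable_tcons (R : realType) (n : nat) :
  measurable_fun setT (@tcons R n).
Proof. exact: measurable_cons. Qed.

HB.instance Definition _ (R : realType) (n : nat) :=
  isMeasurableFun.Build _ _ _ _ (@tcons R n) (@measurable_tcons R n).

(* The n-fold product of haar_circle: the library has binary products only, so
   it is transported along the identification of T x T^n with T^(n+1). *)
Fixpoint haar_torus (R : realType) (n : nat) :
    probability (n.-tuple (measurableTypeR R)) R :=
  if n is m.+1 return probability (n.-tuple (measurableTypeR R)) R then
    distribution (haar_circle R \x haar_torus R m)%E (@tcons R m)
  else \d_[tuple].

(* Main.v *)
Require Import Defs.
From mathcomp Require Import all_boot all_order all_algebra.
From mathcomp Require Import all_classical all_reals all_analysis.
From mathcomp Require Import measurable_realfun complex.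
From mathcomp Require Import ring lra.

(** Take [G0 = [[a, b], [b, a]]] and [G1 = [[a, -b], [-b, a]]] with
    [a^2 = 1 + x], [b^2 = x].  Then [|a_1(t)|^2 = 1 + 4 x (1 + x) sin^2 (pi t)],
    so as [x -> 0] the left-hand side is about [2 sqrt x] times the [L^q] norm of
    [sin (pi t)], while the right-hand side is about [2^(1/p) sqrt x].  The
    inequality therefore fails for small [x] as soon as
    [2^(q/p) < 2^q int_0^1 sin (pi t)^q dt], and the right-hand side here is the
    central binomial coefficient of [q].

    Only the lower bound on the integral is needed.  As functions of [q], the
    integral (times [2^q]) and the central binomial coefficient satisfy the same
    recurrence [(q + 2) f (q + 2) = 4 (q + 1) f q] and agree at [q = 0], hence at
    all even integers; log-convexity estimates for Gamma and monotonicity of the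
    integral transfer this to all [q] asymptotically, and the recurrence then
    brings it back to finite [q].

    Part (i) is the case [d = 1]. *)

Set Implicit Arguments.
Unset Strict Implicit.
Unset Printing Implicit Defensive.

Import Order.TTheory GRing.Theory Num.Theory.
Import numFieldNormedType.Exports.
Import ComplexField.

Local Open Scope ring_scope.
Local Open Scope complex_scope.

(** * Euler's Gamma integral for arguments at least 1 *)

Section gamma.
Local Open Scope classical_set_scope.
Local Open Scope ring_scope.
Variable R : realType.
Implicit Types a t u x y z : R.
Local Notation mu := (@lebesgue_measure R).

Lemma integrable_EFinZl (D : set R) (f : R -> R) k : measurable D ->
  mu.-integrable D (EFin \o f) -> mu.-integrable D (EFin \o (fun t => k * f t)).
Proof.
move=> mD fi; apply: (@eq_integrable _ _ _ mu _ _ (fun t => k%:E * (EFin \o f) t)%E) => //.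
exact: integrableZl.
Qed.

Lemma integrable_EFinD (D : set R) (f g : R -> R) : measurable D ->
  mu.-integrable D (EFin \o f) -> mu.-integrable D (EFin \o g) ->
  mu.-integrable D (EFin \o (fun t => f t + g t)).
Proof.
move=> mD fi gi.
apply: (@eq_integrable _ _ _ mu _ _ ((EFin \o f) \+ (EFin \o g))%E) => //.
exact: integrableD.
Qed.

Lemma integrable_EFinB (D : set R) (f g : R -> R) : measurable D ->
  mu.-integrable D (EFin \o f) -> mu.-integrable D (EFin \o g) ->
  mu.-integrable D (EFin \o (fun t => f t - g t)).
Proof.
move=> mD fi gi.
apply: (@eq_integrable _ _ _ mu _ _ ((EFin \o f) \- (EFin \o g))%E) => //.
exact: integrableB.
Qed.

(** For a > 0, [powR] takes a default value on negative arguments that breaks continuity at 0. The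
    absolute value repairs this, so later antiderivatives are continuous up to the endpoints of
    their intervals. *)
Lemma continuous_norm_powR a : 0 <= a -> continuous (fun y : R => `|y| `^ a).
Proof.
rewrite le_eqVlt => /predU1P[<-|a0] y.
  under [X in continuous_at _ X]eq_fun do rewrite powRr0.
  exact: cvg_cst.
have [->|y0] := eqVneq y 0.
  rewrite /continuous_at normr0 powR0 ?gt_eqF//.
  apply/cvgrPdist_le => e e0; near=> z.
  rewrite sub0r normrN ger0_norm ?powR_ge0//.
  rewrite -[leRHS](powRr1 (ltW e0)) -(mulVf (lt0r_neq0 a0)) powRrM.
  rewrite ge0_ler_powR ?nnegrE ?powR_ge0 ?(ltW a0)//.
  near: z; apply: (@nbhs0_le R R); rewrite powR_gt0//.
apply: (@continuous_comp _ _ _ (fun y : R => `|y|) (fun t => t `^ a)).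
  exact: norm_continuous.
apply/differentiable_continuous/derivable1_diffP.
by apply: derivable_powR; rewrite in_itv/= andbT normr_gt0.
Unshelve. all: by end_near. Qed.

(** Raising t / (2 a) <= e^(t / (2 a)) to the power a gives t^a <= (2 a)^a e^(t/2). Half of the
    exponential decay thus absorbs the power, which yields integrability and the limit at
    infinity. *)
Lemma powR_expRN_bound a : 0 <= a ->
  exists2 C : R, 0 <= C &
    forall t, 0 <= t -> t `^ a * expR (- t) <= C * expR (- (t / 2)).
Proof.
rewrite le_eqVlt => /predU1P[<-|a0].
  exists 1 => // t t0; rewrite powRr0 !mul1r ler_expR; lra.
exists ((2 * a) `^ a); first exact: powR_ge0.
move=> t t0.
have -> : - t = t / 2 * -1 - t / 2 by lra.
rewrite expRD mulrA ler_wpM2r ?expR_ge0//.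
have -> : t / 2 * -1 = - (t / 2) by lra.
rewrite expRN ler_pdivrMr ?expR_gt0//.
have -> : expR (t / 2) = expR (t / (2 * a)) `^ a.
  rewrite /powR gt_eqF ?expR_gt0// expRK; congr expR; field.
  by rewrite gt_eqF.
rewrite -powRM ?expR_ge0 ?mulr_ge0 ?(ltW a0)//.
rewrite ge0_ler_powR ?nnegrE ?mulr_ge0 ?expR_ge0 ?(ltW a0)//.
rewrite -ler_pdivrMl ?mulr_gt0// mulrC.
by apply: le_trans (expR_ge1Dx _); rewrite lerDr.
Qed.

Lemma cvg_expRN_half : expR (- (t / 2)) @[t --> +oo] --> (0 : R).
Proof.
apply: (@cvg_comp _ _ _ (fun t : R => t / 2) (fun t => expR (- t)) _ +oo).
  by apply: gt0_cvgMly => //; rewrite invr_gt0.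
exact: cvgr_expR.
Qed.

Lemma is_derive_expRN_half t :
  is_derive t (1 : R) (fun t : R => expR (- (t / 2))) (- 2^-1 * expR (- (t / 2))).
Proof.
apply: trigger_derive; rewrite /GRing.scale/=; ring.
Qed.

Lemma continuous_expRN_half : continuous (fun t : R => expR (- (t / 2))).
Proof.
move=> t; apply/differentiable_continuous/derivable1_diffP.
by case: (is_derive_expRN_half t).
Qed.

Lemma integral_expRN_half :
  (\int[mu]_(t in `[0%R, +oo[) (expR (- (t / 2)))%:E = 2%:E)%E.
Proof.
rewrite (@ge0_continuous_FTC2y _ _ (fun t => - 2 * expR (- (t / 2))) _ 0).
- by rewrite mul0r oppr0 expR0 mulr1 sub0e -EFinN opprK.
- by move=> t _; exact: expR_ge0.
- exact/continuous_subspaceT/continuous_expRN_half.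
- rewrite -(mulr0 (-2)); apply: cvgMr; exact: cvg_expRN_half.
- by move=> t _; apply: derivableM.
- apply/cvg_at_right_filter; apply: cvgMr; exact: continuous_expRN_half.
- move=> t _; rewrite derive1E deriveM//.
  have [_ ->] := is_derive_expRN_half t.
  by rewrite derive_cst scaler0 addr0 /GRing.scale/=; field.
Qed.

Lemma integrable_expRN_half :
  mu.-integrable `[0, +oo[ (EFin \o (fun t : R => expR (- (t / 2)))).
Proof.
apply/integrableP; split.
  apply/measurable_EFinP/measurable_funTS.
  apply: continuous_measurable_fun; exact: continuous_expRN_half.
under eq_integral do rewrite /= ger0_norm ?expR_ge0//.
by rewrite integral_expRN_half ltry.
Qed.

Lemma measurable_Gamma_integrand a :
  measurable_fun setT (fun t : R => t `^ a * expR (- t)).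
Proof.
apply: measurable_funM; first exact: measurable_powR.
apply: measurableT_comp; first exact: measurable_expR.
exact: oppr_measurable.
Qed.

Lemma integrable_Gamma_integrand a : 0 <= a ->
  mu.-integrable `[0, +oo[ (EFin \o (fun t : R => t `^ a * expR (- t))).
Proof.
move=> a0; have [C C0 bC] := powR_expRN_bound a0.
apply: (@le_integrable _ _ _ mu _ _ _
   (fun t => C%:E * (EFin \o (fun t : R => expR (- (t / 2)))) t)%E) => //.
- apply/measurable_EFinP/measurable_funTS; exact: measurable_Gamma_integrand.
- move=> t /=; rewrite in_itv/= andbT => t0.
  rewrite lee_fin !ger0_norm ?mulr_ge0 ?powR_ge0 ?expR_ge0//.
  exact: bC.
- exact/integrableZl/integrable_expRN_half.
Qed.

(** With a nonnegative exponent the integrand is integrable on the closed half-line, so the endpoint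
    0 can be added. The arguments q + 1 and q / 2 + 1 of the central binomial coefficient lie in
    this range. *)
Lemma GammaE x : 1 <= x ->
  Gamma x = \int[mu]_(t in `[0, +oo[) (t `^ (x - 1) * expR (- t)).
Proof.
move=> x1; rewrite /Gamma Rintegral_itv_obnd_cbnd//.
apply: integrableS (integrable_Gamma_integrand _) => //.
  by apply: subset_itvr; rewrite bnd_simp.
by rewrite subr_ge0.
Qed.

Lemma Gamma1 : Gamma 1 = 1 :> R.
Proof.
rewrite GammaE// subrr.
under eq_Rintegral do rewrite powRr0 mul1r.
(* The integral is the total mass of the exponential law of rate 1. *)
have := @integral_exponential_pdf R 1 ltr01.
have -> : (fun x => (exponential_pdf 1 x)%:E) =
    (fun x => (EFin \o (fun t : R => expR (- t))) x) \_ `[0, +oo[.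
  apply/funext => t /=; rewrite /exponential_pdf restrict_EFin; congr EFin.
  rewrite !patchE; case: ifPn => //_; by rewrite mul1r mulN1r.
by rewrite -integral_mkcond /Rintegral /= => ->.
Qed.

Lemma GammaS x : 1 <= x -> Gamma (x + 1) = x * Gamma x.
Proof.
move=> x1; have x0 : 0 < x by lra.
have x10 : 0 <= x - 1 by lra.
have [C C0 bC] := powR_expRN_bound x10.
have [C' C'0 bC'] := powR_expRN_bound (ltW x0).
(* The derivative of [- t^x e^-t] changes sign; adding a multiple of [e^(-t/2)]
   makes it nonnegative, as [ge0_continuous_FTC2y] requires.  The absolute
   values make [f] and [F] continuous on the whole line. *)
pose f t := (`|t| `^ x * expR (- t) - x * (`|t| `^ (x - 1) * expR (- t))) +
            (x * C) * expR (- (t / 2)).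
pose F t := - (`|t| `^ x * expR (- t)) + - (2 * (x * C)) * expR (- (t / 2)).
have cexpN : continuous (fun t : R => expR (- t)).
  move=> t; apply: (@continuous_comp _ _ _ (fun t : R => - t) expR).
    exact: opp_continuous.
  exact: continuous_expR.
have cf : continuous f.
  move=> t; apply: cvgD; [apply: cvgB; [apply: cvgM|apply: cvgMr; apply: cvgM]|apply: cvgMr].
  - exact: (continuous_norm_powR (ltW x0)).
  - exact: cexpN.
  - exact: (continuous_norm_powR x10).
  - exact: cexpN.
  - exact: continuous_expRN_half.
have cF : continuous F.
  move=> t; apply: cvgD; [apply: cvgN; apply: cvgM|apply: cvgMr].
  - exact: (continuous_norm_powR (ltW x0)).
  - exact: cexpN.
  - exact: continuous_expRN_half.
have dF t : 0 < t -> is_derive t (1 : R) F (f t).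
  move=> t0.
  (* Dropping the absolute values, which is harmless near a positive t, lets the derivative rule for
     powers apply. *)
  pose G := fun t => - (t `^ x * expR (- t)) + - (2 * (x * C)) * expR (- (t / 2)).
  have nG : \forall z \near t, G z = F z.
    near=> z; rewrite /F /G ger0_norm//; apply: ltW.
    near: z; exact: lt_nbhsr.
  have dG : is_derive t (1 : R) G (f t).
    have ? := is_derive1_powR x t0.
    have ? := is_derive_expRN_half t.
    apply: trigger_derive; rewrite /GRing.scale/= /f ger0_norm ?ltW//.
    by field.
  case: dG => dG1 dG2; split.
    by apply: near_eq_derivable dG1.
  by rewrite -dG2; apply/esym/near_eq_derive.
have intf : (\int[mu]_(t in `[0%R, +oo[) (f t)%:E = (2 * (x * C))%:E)%E.
  rewrite (@ge0_continuous_FTC2y _ f F 0 0) //.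
  - rewrite /F mul0r oppr0 normr0 powR0 ?gt_eqF// mul0r oppr0 add0r expR0 mulr1.
    by rewrite sub0r -EFinN opprK.
  - move=> t t0; rewrite /f ger0_norm//.
    rewrite -addrA addr_ge0 ?mulr_ge0 ?powR_ge0 ?expR_ge0//.
    rewrite addrC subr_ge0 -mulrA ler_wpM2l ?(ltW x0)//.
    exact: bC.
  - exact: continuous_subspaceT.
  - rewrite -(addr0 0); apply: cvgD; last first.
      rewrite -(mulr0 (- (2 * (x * C)))); apply: cvgMr; exact: cvg_expRN_half.
    rewrite -oppr0; apply: cvgN.
    apply: (@squeeze_cvgr _ _ _ _ (fun=> 0) (fun t => C' * expR (- (t / 2)))).
    + near=> t; rewrite mulr_ge0 ?powR_ge0 ?expR_ge0//=.
      by rewrite ger0_norm// bC'.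
    + exact: cvg_cst.
    + rewrite -(mulr0 C'); apply: cvgMr; exact: cvg_expRN_half.
  - by move=> t t0; case: (dF t t0).
  - exact/cvg_at_right_filter/cF.
  - move=> t; rewrite in_itv/= andbT => t0; rewrite derive1E.
    by case: (dF t t0).
have : \int[mu]_(t in `[0, +oo[) (f t) = 2 * (x * C).
  by rewrite /Rintegral intf.
have -> : \int[mu]_(t in `[0, +oo[) (f t) =
  \int[mu]_(t in `[0, +oo[) ((t `^ x * expR (- t) - x * (t `^ (x - 1) * expR (- t))) +
            (x * C) * expR (- (t / 2))).
  apply: eq_Rintegral => t /[!inE]/=; rewrite in_itv/= andbT => t0.
  by rewrite /f ger0_norm.
have i1 := integrable_Gamma_integrand (ltW x0).
have i2 := integrable_Gamma_integrand x10.
have i2' : mu.-integrable `[0, +oo[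
    (EFin \o (fun t : R => x * (t `^ (x - 1) * expR (- t)))).
  exact: integrable_EFinZl.
have i3 : mu.-integrable `[0, +oo[
    (EFin \o (fun t : R => (x * C) * expR (- (t / 2)))).
  exact/integrable_EFinZl/integrable_expRN_half.
have i4 : mu.-integrable `[0, +oo[
    (EFin \o (fun t : R => t `^ x * expR (- t) - x * (t `^ (x - 1) * expR (- t)))).
  exact: integrable_EFinB.
(* The added exponential contributes 2 x C, which is also the value of the whole integral;
   cancelling it leaves the functional equation. *)
rewrite RintegralD// RintegralB// !RintegralZl//; last exact: integrable_expRN_half.
rewrite [X in _ + _ * _ * X](_ : _ = 2); last first.
  by rewrite /Rintegral integral_expRN_half.
rewrite -GammaE// [X in X - _](_ : _ = Gamma (x + 1)); last first.
  by rewrite GammaE ?addrK//; lra.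
move=> h; lra.
Unshelve. all: by end_near. Qed.

(** The right-hand side is the tangent line at x of the concave function t^u. With r = t / x it
    becomes Bernoulli's inequality r^u <= 1 + u (r - 1), which is the concavity of [ln] between 1
    and r. *)
Lemma powR_bernoulli t x u : 0 <= t -> 0 < x -> 0 <= u -> u <= 1 ->
  t `^ u <= x `^ u * (1 - u) + u * x `^ (u - 1) * t.
Proof.
rewrite le_eqVlt => /predU1P[<-|t0] x0 u0 u1.
  rewrite mulr0 addr0; have [->|un0] := eqVneq u 0.
    by rewrite !powRr0 mul1r subr0.
  by rewrite powR0// mulr_ge0 ?powR_ge0// subr_ge0.
have -> : x `^ (u - 1) = x `^ u / x.
  by rewrite powRB ?powRr1 ?(ltW x0)// (gt_eqF x0)/= implybT.
have -> : x `^ u * (1 - u) + u * (x `^ u / x) * t =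
          x `^ u * (1 + u * (t / x - 1)) by ring.
rewrite -ler_pdivrMl ?powR_gt0//.
set r := t / x.
have r0 : 0 < r by rewrite divr_gt0.
have -> : (x `^ u)^-1 * t `^ u = r `^ u.
  by rewrite /r powRM ?invr_ge0 ?ltW// -(powR_inv1 (ltW x0)) -powRrM mulN1r powRN mulrC.
have s0 : 0 < 1 + u * (r - 1) by nra.
rewrite -ler_ln ?posrE ?powR_gt0// ln_powR.
have i01 : 0 <= 1 - u <= 1 by apply/andP; split; lra.
have := @concave_ln R (Itv01 (proj1 (andP i01)) (proj2 (andP i01))) _ _ ltr01 r0.
rewrite !convRE/= /unstable.onem ln1 mulr0 add0r mulr1.
by congr (_ * _ <= ln _); ring.
Qed.

(** This is Jensen's inequality for the Gamma law of mean x: integrate the tangent line of t^u at t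
    = x against t^(x-1) e^(-t). By [GammaS] the constant and linear terms of the line add up to x^u
    Gamma(x). *)
Lemma Gamma_shift_le x u : 1 <= x -> 0 <= u -> u <= 1 ->
  Gamma (x + u) <= x `^ u * Gamma x.
Proof.
move=> x1 u0 u1; have x0 : 0 < x by lra.
have x10 : 0 <= x - 1 by lra.
have -> : x `^ u * Gamma x =
    x `^ u * (1 - u) * Gamma x + u * x `^ (u - 1) * Gamma (x + 1).
  have -> : x `^ (u - 1) = x `^ u / x.
    by rewrite powRB ?powRr1 ?(ltW x0)// (gt_eqF x0)/= implybT.
  by rewrite GammaS//; field; rewrite gt_eqF.
rewrite !GammaE; [|lra..].
rewrite addrK.
have i1 := integrable_Gamma_integrand (ltW x0).
have i2 := integrable_Gamma_integrand x10.
have i1' : mu.-integrable `[0, +oo[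
    (EFin \o (fun t : R => u * x `^ (u - 1) * (t `^ x * expR (- t)))).
  exact: integrable_EFinZl.
have i2' : mu.-integrable `[0, +oo[
    (EFin \o (fun t : R => x `^ u * (1 - u) * (t `^ (x - 1) * expR (- t)))).
  exact: integrable_EFinZl.
rewrite -!RintegralZl// -RintegralD//.
apply: le_Rintegral => //.
- by apply: integrable_Gamma_integrand; lra.
- exact: integrable_EFinD.
- move=> t /=; rewrite in_itv/= andbT => t0.
  rewrite !mulrA -mulrDl ler_wpM2r ?expR_ge0//.
  move: t0; rewrite le_eqVlt => /predU1P[<-|t0].
    rewrite (@powR0 _ x) ?gt_eqF// mulr0 addr0.
    (* At t = 0 the left side is 0^0 = 1 only if x = 1 and u = 0, and then the right side is 1
       too. *)
    have [xu|xu] := eqVneq (x + u - 1) 0.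
      have -> : u = 0 by lra.
      have -> : x = 1 by lra.
      by rewrite powR1 addr0 subrr powRr0 subr0 !mulr1.
    by rewrite powR0// !mulr_ge0 ?powR_ge0//; lra.
  have -> : x + u - 1 = u + (x - 1) by lra.
  rewrite powRD; last by rewrite (gt_eqF t0)/= implybT.
  have -> : t `^ x = t * t `^ (x - 1).
    by rewrite mulr_powRB1 ?ltW.
  rewrite !mulrA -mulrDl ler_wpM2r ?powR_ge0//.
  apply: powR_bernoulli => //; exact: ltW.
Qed.

(** Positivity at integers comes from the functional equation. It passes to x because
    [Gamma_shift_le] bounds Gamma at the next integer by a multiple of Gamma(x). *)
Lemma Gamma_gt0 x : 1 <= x -> 0 < Gamma x.
Proof.
move=> x1.
have Gn (n : nat) : 0 < Gamma (n.+1%:R : R).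
  elim: n => [|n IH]; first by rewrite Gamma1.
  by rewrite -[n.+2%:R]natr1 GammaS ?mulr_gt0// ler1n.
have /andP[nx xn] := truncn_itv (le_trans ler01 x1).
set n := Num.truncn x in nx xn.
have u0 : 0 <= n.+1%:R - x by rewrite subr_ge0 ltW.
have u1 : n.+1%:R - x <= 1 by rewrite lerBlDr -natr1 addrC lerD2l.
have := Gamma_shift_le x1 u0 u1.
rewrite addrC subrK => /(lt_le_trans (Gn _)).
by rewrite pmulr_rgt0// powR_gt0//; lra.
Qed.

End gamma.

(** * Moments of the sine on the unit interval *)

Section sine_moments.
Local Open Scope classical_set_scope.
Local Open Scope ring_scope.
Variable R : realType.
Implicit Types a b t u x y z q : R.
Local Notation mu := (@lebesgue_measure R).

Definition sin_moment a : R := \int[mu]_(t in `[0, 1]) (sin (pi * t) `^ a).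

Lemma sin_pi_ge0 t : 0 <= t -> t <= 1 -> 0 <= sin (pi * t).
Proof.
move=> t0 t1; apply: sin_ge0_pi; rewrite mulr_ge0 ?pi_ge0//=.
by rewrite ler_piMr ?pi_ge0.
Qed.

Lemma sin_pi_gt0 t : 0 < t -> t < 1 -> 0 < sin (pi * t).
Proof.
move=> t0 t1; apply: sin_gt0_pi; rewrite mulr_gt0 ?pi_gt0//=.
by rewrite gtr_pMr ?pi_gt0.
Qed.

Lemma is_derive_sin_pi t :
  is_derive t (1 : R) (fun t : R => sin (pi * t)) (pi * cos (pi * t)).
Proof. by apply: trigger_derive; rewrite /GRing.scale/=; ring. Qed.

Lemma is_derive_cos_pi t :
  is_derive t (1 : R) (fun t : R => cos (pi * t)) (- (pi * sin (pi * t))).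
Proof. by apply: trigger_derive; rewrite /GRing.scale/=; ring. Qed.

Lemma continuous_sin_pi : continuous (fun t : R => sin (pi * t)).
Proof.
move=> t; apply/differentiable_continuous/derivable1_diffP.
by case: (is_derive_sin_pi t).
Qed.

Lemma continuous_cos_pi : continuous (fun t : R => cos (pi * t)).
Proof.
move=> t; apply/differentiable_continuous/derivable1_diffP.
by case: (is_derive_cos_pi t).
Qed.

Lemma continuous_norm_sin_powR a : 0 <= a ->
  continuous (fun t : R => `|sin (pi * t)| `^ a).
Proof.
move=> a0 t.
apply: (@continuous_comp _ _ _ (fun t : R => sin (pi * t)) (fun y : R => `|y| `^ a)).
  exact: continuous_sin_pi.
exact: continuous_norm_powR.
Qed.

Lemma within_continuous_sin_powR a : 0 <= a ->
  {within `[0, 1], continuous (fun t : R => sin (pi * t) `^ a)}.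
Proof.
move=> a0; apply: (@subspace_eq_continuous _ _ _ (fun t : R => `|sin (pi * t)| `^ a)).
  move=> t; rewrite inE/= in_itv/= => /andP[t0 t1].
  by rewrite /from_subspace/= ger0_norm// sin_pi_ge0.
exact/continuous_subspaceT/continuous_norm_sin_powR.
Qed.

Lemma integrable_sin_powR a : 0 <= a ->
  mu.-integrable `[0, 1] (EFin \o (fun t : R => sin (pi * t) `^ a)).
Proof.
move=> a0; apply: continuous_compact_integrable; first exact: segment_compact.
exact: within_continuous_sin_powR.
Qed.

Lemma sin_moment0 : sin_moment 0 = 1.
Proof.
rewrite /sin_moment; under eq_Rintegral do rewrite powRr0.
rewrite Rintegral_cst// mul1r /=.
by rewrite lebesgue_measure_itv/= lte_fin ltr01 oppr0 adde0.
Qed.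

(** Integration by parts: - sin^(a+1) cos / pi vanishes at both endpoints, and with cos^2 = 1 -
    sin^2 its derivative is (a + 2) sin^(a+2) - (a + 1) sin^a. *)
Lemma sin_momentS a : 0 <= a ->
  (a + 2) * sin_moment (a + 2) = (a + 1) * sin_moment a.
Proof.
move=> a0.
have a20 : 0 <= a + 2 by lra.
have a10 : 0 <= a + 1 by lra.
pose f t := (a + 2) * (sin (pi * t) `^ (a + 2)) - (a + 1) * (sin (pi * t) `^ a).
pose G t := - pi^-1 * (`|sin (pi * t)| `^ (a + 1) * cos (pi * t)).
have cG : continuous G.
  move=> t; apply: cvgMr; apply: cvgM.
    exact: (continuous_norm_sin_powR a10).
  exact: continuous_cos_pi.
have dG t : 0 < t -> t < 1 -> is_derive t (1 : R) G (f t).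
  move=> t0 t1; have s0 := sin_pi_gt0 t0 t1.
  (* At interior points the sine is positive and [F] agrees locally with [G]; the absolute value in
     [G] serves continuity at 0 and 1. *)
  pose F := fun t => - pi^-1 * (sin (pi * t) `^ (a + 1) * cos (pi * t)).
  have nF : \forall z \near t, F z = G z.
    near=> z; rewrite /F /G ger0_norm//; apply: sin_pi_ge0; apply: ltW.
      by near: z; exact: lt_nbhsr.
    by near: z; exact: lt_nbhsl.
  have dF : is_derive t (1 : R) F (f t).
    have d1 := is_derive_sin_pi t.
    have d2 := is_derive_cos_pi t.
    have d3 := is_derive1_powR (a + 1) s0.
    have d4 := @is_derive1_comp R (fun y => powR y (a + 1)) (fun t => sin (pi * t)) t _ _ d3 d1.
    apply: trigger_derive; rewrite /GRing.scale/= /f addrK.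
    have -> : sin (pi * t) `^ (a + 1) = sin (pi * t) * sin (pi * t) `^ a.
      by rewrite addrC powRD ?powRr1 ?(ltW s0)// (gt_eqF s0)/= implybT.
    have -> : sin (pi * t) `^ (a + 2) = sin (pi * t) ^+ 2 * sin (pi * t) `^ a.
      rewrite addrC powRD; last by rewrite (gt_eqF s0)/= implybT.
      by rewrite powR_mulrn ?ltW.
    have := cos2Dsin2 (pi * t) => cs.
    have pi0 : pi != 0 :> R by rewrite gt_eqF ?pi_gt0.
    rewrite [LHS](_ : _ = sin (pi * t) ^+ 2 * sin (pi * t) `^ a -
        (a + 1) * (sin (pi * t) `^ a) * cos (pi * t) ^+ 2); last first.
      by move: (sin _) (cos _) => s c; move: pi pi0 => P P0; field.
    have -> : cos (pi * t) ^+ 2 = 1 - sin (pi * t) ^+ 2 by rewrite -cs addrK.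
    by ring.
  case: dF => dF1 dF2; split.
    by apply: near_eq_derivable dF1.
  by rewrite -dF2; apply/esym/near_eq_derive.
have intf : (\int[mu]_(t in `[0%R, 1%R]) (f t)%:E = 0)%E.
  rewrite (@continuous_FTC2 _ f G 0 1) //.
  - by rewrite /G mulr0 mulr1 sin0 sinpi normr0 powR0 ?mul0r ?mulr0 ?subee// gt_eqF//; lra.
  - move=> t; apply: cvgB; apply: cvgMr.
      exact: (within_continuous_sin_powR a20).
    exact: (within_continuous_sin_powR a0).
  - split.
    + by move=> t; rewrite in_itv/= => /andP[t0 t1]; case: (dG t t0 t1).
    + exact/cvg_at_right_filter/cG.
    + exact/cvg_at_left_filter/cG.
  - move=> t; rewrite in_itv/= => /andP[t0 t1]; rewrite derive1E.
    by case: (dG t t0 t1).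
have : \int[mu]_(t in `[0, 1]) (f t) = 0 by rewrite /Rintegral intf.
have i1 := integrable_sin_powR a0.
have i2 := integrable_sin_powR a20.
rewrite /f RintegralB//; [|exact: integrable_EFinZl..].
rewrite !RintegralZl// => /eqP; rewrite subr_eq0 => /eqP //.
Unshelve. all: by end_near. Qed.

Lemma sin_moment_le a b : 0 < a -> a <= b -> sin_moment b <= sin_moment a.
Proof.
move=> a0 ab; apply: le_Rintegral => //.
- by apply: integrable_sin_powR; lra.
- by apply: integrable_sin_powR; lra.
- move=> t /=; rewrite in_itv/= => /andP[t0 t1].
  have := sin_pi_ge0 t0 t1; rewrite le_eqVlt => /predU1P[<-|s0].
    by rewrite !powR0// gt_eqF//; lra.
  by apply: ger_powR => //; rewrite s0 sin_le1.
Qed.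

(** * Comparison of the central binomial coefficient with the sine moments *)

Lemma central_binom0 : central_binom 0 = 1 :> R.
Proof. by rewrite /central_binom mul0r add0r Gamma1 expr1n divr1. Qed.

Lemma central_binom_gt0 a : 0 <= a -> 0 < central_binom a.
Proof.
by move=> a0; rewrite divr_gt0 ?exprn_gt0 ?Gamma_gt0//; lra.
Qed.

Lemma central_binomS a : 0 <= a ->
  (a + 2) * central_binom (a + 2) = 4 * (a + 1) * central_binom a.
Proof.
move=> a0; rewrite /central_binom.
have -> : a + 2 + 1 = a + 1 + 1 + 1 by ring.
have -> : (a + 2) / 2 + 1 = a / 2 + 1 + 1 by field.
rewrite (@GammaS _ (a + 1 + 1)) ?(@GammaS _ (a + 1)) ?(@GammaS _ (a / 2 + 1)); [|lra..].
have : Gamma (a / 2 + 1) != 0 by rewrite gt_eqF ?Gamma_gt0//; lra.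
move=> g0; field.
rewrite g0/=; apply/negP => /eqP; lra.
Qed.

(** Shifting from x + u by 1 - u with [Gamma_shift_le] reaches Gamma(x + 1) = x Gamma(x). The free
    bound y lets successive shifts share one constant. *)
Lemma Gamma_shift_ge x y u : 1 <= x -> 0 <= u -> u <= 1 -> x + u <= y ->
  x * Gamma x <= y `^ (1 - u) * Gamma (x + u).
Proof.
move=> x1 u0 u1 xy.
have xu1 : 1 <= x + u by lra.
have u10 : 0 <= 1 - u by lra.
have u11 : 1 - u <= 1 by lra.
have y0 : 0 <= y by lra.
have xu0 : 0 <= x + u by lra.
have := Gamma_shift_le xu1 u10 u11.
have -> : x + u + (1 - u) = x + 1 by ring.
rewrite (GammaS x1) => /le_trans; apply.
by rewrite ler_wpM2r ?(ltW (Gamma_gt0 _))// ge0_ler_powR ?nnegrE.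
Qed.

(** A step of 2 u multiplies the coefficient by nearly 4^u. The numerator is bounded below by two
    shifts by u, and each Gamma factor of the denominator is bounded above by one. *)
Lemma central_binom_growth z u : 0 <= z -> 0 <= u -> u <= 1 ->
  4 `^ u * ((z + 1) / (z + 3)) ^+ 2 * central_binom z <= central_binom (z + 2 * u).
Proof.
move=> z0 u0 u1.
have z1 : 1 <= z + 1 by lra.
have z1u : 1 <= z + 1 + u by lra.
have z10 : 0 <= z + 1 by lra.
have z30 : 0 < z + 3 by lra.
have z320 : 0 < (z + 3) / 2 by lra.
have z21 : 1 <= z / 2 + 1 by lra.
have z21u : 1 <= z / 2 + 1 + u by lra.
have z23 : z / 2 + 1 <= (z + 3) / 2 by lra.
have u10 : 0 <= 1 - u by lra.
have h1 : z + 1 + u <= z + 3 by lra.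
have h2 : z + 1 + u + u <= z + 3 by lra.
have g0 : 0 < Gamma (z / 2 + 1) by exact: Gamma_gt0.
have g1 : 0 < Gamma (z / 2 + 1 + u) by exact: Gamma_gt0.
have g2 : 0 <= Gamma (z + 1) by exact/ltW/Gamma_gt0.
(* Every base occurring in the shifts is at most z + 3 in the numerator and (z + 3) / 2 in the
   denominator; with these common bounds 2^u c d is exactly z + 3. *)
set c := (z + 3) `^ (1 - u); set d := ((z + 3) / 2) `^ u.
have c0 : 0 < c by exact: powR_gt0.
have d0 : 0 < d by exact: powR_gt0.
have p0 : 0 < 2 `^ u :> R by exact: powR_gt0.
have cd : 2 `^ u * c * d = z + 3.
  rewrite /c /d mulrAC -powRM ?(ltW z320)//.
  have -> : 2 * ((z + 3) / 2) = z + 3 by field.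
  rewrite -powRD; last by rewrite (gt_eqF z30) implybT.
  have -> : u + (1 - u) = 1 by ring.
  by rewrite powRr1// ltW.
have s1 : (z + 1) * Gamma (z + 1) <= c * Gamma (z + 1 + u) by exact: Gamma_shift_ge.
have s2 : (z + 1) * Gamma (z + 1 + u) <= c * Gamma (z + 1 + u + u).
  apply: le_trans (Gamma_shift_ge z1u u0 u1 h2).
  by rewrite ler_wpM2r ?(ltW (Gamma_gt0 _))// lerDl.
have s3 : Gamma (z / 2 + 1 + u) <= d * Gamma (z / 2 + 1).
  apply: le_trans (Gamma_shift_le z21 u0 u1) _.
  by rewrite ler_wpM2r ?(ltW g0)// ge0_ler_powR ?nnegrE ?(ltW z320)// (le_trans ler01).
rewrite /central_binom.
have -> : z + 2 * u + 1 = z + 1 + u + u by ring.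
have -> : (z + 2 * u) / 2 + 1 = z / 2 + 1 + u by field.
have -> : 4 `^ u = (2 `^ u) ^+ 2 :> R.
  by rewrite expr2 -powRM//; congr (_ `^ _); ring.
have s12 : (z + 1) ^+ 2 * Gamma (z + 1) <= c ^+ 2 * Gamma (z + 1 + u + u).
  rewrite !expr2 -!mulrA.
  apply: (@le_trans _ _ ((z + 1) * (c * Gamma (z + 1 + u)))).
    exact: (ler_wpM2l z10 s1).
  by rewrite mulrCA; exact: (ler_wpM2l (ltW c0) s2).
rewrite (_ : (z + 1) / (z + 3) = (z + 1) / (2 `^ u * c * d)); last by rewrite cd.
move: p0 g0 g1 g2 c0 d0 s12 s3 {s1 s2 cd}.
move: (2 `^ u) (Gamma (z / 2 + 1)) (Gamma (z / 2 + 1 + u)) (Gamma (z + 1 + u + u))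
  (Gamma (z + 1)) @c @d => P A A' B B' c d p0 A0 A'0 B'0 c0 d0 s12 s3.
rewrite ler_pdivlMr ?exprn_gt0//.
(* The first factor is at most [B] by [s12], and the squared one is at most 1 by [s3]. *)
rewrite [leLHS](_ : _ = ((z + 1) ^+ 2 * B') / c ^+ 2 * (A' / (d * A)) ^+ 2); last first.
  by field; rewrite !gt_eqF.
rewrite -[B]mulr1; apply: ler_pM.
- by rewrite divr_ge0 ?mulr_ge0 ?exprn_ge0 ?(ltW c0).
- by rewrite sqr_ge0.
- by rewrite ler_pdivrMr ?exprn_gt0// mulrC [leRHS]mulrC mulrC.
- rewrite expr_le1 ?divr_ge0 ?mulr_ge0 ?(ltW A'0) ?(ltW A0) ?(ltW d0)//.
  by rewrite ler_pdivrMr ?mul1r ?mulr_gt0.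
Qed.

Lemma sin_moment_recE a : 0 <= a ->
  (a + 2) * (2 `^ (a + 2) * sin_moment (a + 2)) =
  4 * (a + 1) * (2 `^ a * sin_moment a).
Proof.
move=> a0; rewrite mulrCA sin_momentS// powRD; last by rewrite pnatr_eq0 implybT.
rewrite powR_mulrn//; ring.
Qed.

(** Two solutions of the same recurrence have a constant quotient along a, a + 2, a + 4, and so on;
    cross products avoid dividing. *)
Lemma sin_moment_central_binom_shift a (k : nat) : 0 <= a ->
  2 `^ (a + 2 * k%:R) * sin_moment (a + 2 * k%:R) * central_binom a =
  2 `^ a * sin_moment a * central_binom (a + 2 * k%:R).
Proof.
move=> a0; elim: k => [|k IH]; first by rewrite mulr0 addr0.
have ak0 : 0 <= a + 2 * k%:R by rewrite addr_ge0 ?mulr_ge0.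
have -> : a + 2 * k.+1%:R = a + 2 * k%:R + 2 by rewrite -natr1; ring.
have b20 : a + 2 * k%:R + 2 != 0 by rewrite gt_eqF// ltr_wpDl.
have e1 := sin_moment_recE ak0.
have e2 := central_binomS ak0.
set b := a + 2 * k%:R in ak0 b20 e1 e2 IH *.
apply: (mulfI b20).
by rewrite mulrA e1 [RHS]mulrCA e2 -[LHS]mulrA IH [RHS]mulrCA.
Qed.

Lemma sin_moment_even (n : nat) :
  2 `^ (2 * n%:R) * sin_moment (2 * n%:R) = central_binom (2 * n%:R : R).
Proof.
have := sin_moment_central_binom_shift n (lexx (0 : R)).
by rewrite !add0r central_binom0 mulr1 powRr0 mul1r sin_moment0 mul1r.
Qed.

(** Round z up to an even integer z + 2 u, where both sequences agree. On the way the coefficient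
    gains almost 4^u, the weight 2^z gains exactly 4^u, and the sine moment does not increase. *)
Lemma central_binom_le_sin_moment_approx z : 0 < z ->
  ((z + 1) / (z + 3)) ^+ 2 * central_binom z <= 2 `^ z * sin_moment z.
Proof.
move=> z0.
have z20 : 0 <= z / 2 by lra.
have /andP[nz] := truncn_itv z20.
set n := Num.truncn (z / 2) in nz *; rewrite -[n.+1%:R]natr1 => zn.
pose u : R := n%:R + 1 - z / 2.
have u0 : 0 <= u by rewrite subr_ge0 ltW.
have u1 : u <= 1 by rewrite /u lerBlDr [leRHS]addrC lerD2r.
have zu : z + 2 * u = 2 * n.+1%:R by rewrite -[n.+1%:R]natr1 /u; field.
have p4 : 0 < 4 `^ u :> R by exact: powR_gt0.
have e4 : 2 `^ (z + 2 * u) = 2 `^ z * 4 `^ u :> R.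
  rewrite powRD; last by rewrite pnatr_eq0 implybT.
  by rewrite powRrM powR_mulrn// -natrX.
have mono : sin_moment (z + 2 * u) <= sin_moment z.
  by apply: (sin_moment_le z0); rewrite lerDl mulr_ge0.
have := central_binom_growth (ltW z0) u0 u1.
rewrite zu -sin_moment_even -zu e4 => gr.
rewrite -(ler_pM2l p4) mulrA; apply: le_trans gr _.
by rewrite [leRHS]mulrCA -mulrA ler_wpM2l ?powR_ge0// ler_wpM2l ?powR_ge0.
Qed.

(** The approximate bound at q + 2 k pulls back to q because the quotient is the same there, and its
    error factor tends to 1 as k grows. *)
Lemma central_binom_le_sin_moment q : 0 < q ->
  central_binom q <= 2 `^ q * sin_moment q.
Proof.
move=> q0.
have cq0 := central_binom_gt0 (ltW q0).
have key (k : nat) : ((q + 2 * k%:R + 1) / (q + 2 * k%:R + 3)) ^+ 2 * central_binom q <=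
    2 `^ q * sin_moment q.
  have z0 : 0 < q + 2 * k%:R by rewrite ltr_wpDr ?mulr_ge0.
  have cz0 := central_binom_gt0 (ltW z0).
  rewrite -(ler_pM2r cz0) -sin_moment_central_binom_shift ?(ltW q0)//.
  rewrite mulrAC (ler_wpM2r (ltW cq0))//.
  exact: central_binom_le_sin_moment_approx.
move: (2 `^ q * sin_moment q) (central_binom q) cq0 key => X cb cq0 key.
rewrite leNgt; apply/negP => lt.
(* With w = 2 / (q + 2 k + 3) the error factor is (1 - w)^2 >= 1 - 2 w, so a gap cb - X > 0 would
   force (cb - X) (q + 2 k + 3) <= 4 cb. This k is too large for that. *)
pose k := (Num.truncn (4 * cb / (cb - X))).+1.
have hk : 4 * cb / (cb - X) < k%:R by exact: truncnS_gt.
rewrite ltr_pdivrMr in hk; last by rewrite subr_gt0.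
have k0 : 0 <= k%:R :> R by exact: ler0n.
move: (key k) k0 hk; move: (k%:R : R) => K {k key} h K0 hK.
have zK : K <= q + 2 * K + 3 by lra.
have z30 : 0 < q + 2 * K + 3 by lra.
have eK : (q + 2 * K + 1) / (q + 2 * K + 3) = 1 - 2 / (q + 2 * K + 3).
  by field; rewrite gt_eqF.
move: h zK z30; rewrite {}eK; move: (q + 2 * K + 3) => z h zK z0.
have wz : 2 / z * z = 2 by rewrite mulfVK// gt_eqF.
have w0 : 0 < 2 / z by rewrite divr_gt0.
move: (2 / z) wz w0 h => w wz w0 h.
have h2 : (1 - 2 * w) * cb <= X.
  by apply: le_trans h; rewrite ler_wpM2r ?(ltW cq0)//; nra.
have h3 : cb - X <= 2 * w * cb by lra.
have h4 : (cb - X) * z <= 4 * cb.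
  apply: (@le_trans _ _ (2 * w * cb * z)); first by rewrite ler_wpM2r// ltW.
  have -> : 2 * w * cb * z = 2 * cb * (w * z) by ring.
  by rewrite wz; lra.
have h5 : (cb - X) * K <= (cb - X) * z by rewrite ler_wpM2l// subr_ge0 ltW.
lra.
Qed.

End sine_moments.

(** * Two-factor products in SU(1,1) *)

Section matrices.
Variable R : realType.
Implicit Types t x : R.

Lemma mulmx22 (a b c d a' b' c' d' : R[i]) :
  mx22 a b c d *m mx22 a' b' c' d' =
  mx22 (a * a' + b * c') (a * b' + b * d') (c * a' + d * c') (c * b' + d * d').
Proof.
apply/matrixP => i j; rewrite !mxE !big_ord_recl big_ord0 addr0 !mxE /=.
by case: ifP => _; case: ifP.
Qed.

Lemma mx22_1 : mx22 1 0 0 1 = 1%:M :> 'M[R[i]]_2.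
Proof.
by apply/matrixP => i j; rewrite !mxE; case: i => [[|[|//]]] ?; case: j => [[|[|//]]] ?.
Qed.

Lemma expiMN t : expi t * expi (- t) = 1.
Proof.
rewrite /expi cosN sinN; apply/eqP; rewrite eq_complex /=; apply/andP; split.
  by rewrite mulrN opprK -!expr2 cos2Dsin2.
by rewrite mulrN mulrC addNr.
Qed.

Lemma invmx_Dmx t :
  invmx (Dmx t) = mx22 (expi (- (pi * t))) 0 0 (expi (pi * t)).
Proof.
set E := mx22 _ _ _ _.
have DE : Dmx t *m E = 1%:M.
  rewrite /Dmx /E mulmx22 !mulr0 !mul0r !addr0 add0r -mx22_1.
  by rewrite expiMN mulrC expiMN.
have [uD _] := mulmx1_unit DE.
by rewrite -[LHS]mulmx1 -DE mulmxA mulVmx// mul1mx.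
Qed.

Definition hyp_rot (a b : R) : 'M[R[i]]_2 := mx22 a%:C b%:C b%:C a%:C.

Lemma normc_real (a : R) : Normc.normc a%:C ^+ 2 = a ^+ 2.
Proof. by rewrite /= expr0n addr0 sqr_sqrtr ?sqr_ge0. Qed.

Lemma SU11_hyp_rot (a b : R) : a ^+ 2 - b ^+ 2 = 1 -> SU11 (hyp_rot a b).
Proof.
move=> ab; exists a%:C, b%:C; split; last by rewrite !normc_real.
have conj_real (c : R) : (c%:C)^* = c%:C by rewrite /= oppr0.
by rewrite !conj_real.
Qed.

Lemma normc_hyp_rot (a b : R) : Normc.normc (hyp_rot a b 0 0) ^+ 2 = a ^+ 2.
Proof. by rewrite mxE normc_real. Qed.

(** The entry is a^2 - b^2 e^(-2 pi i t), whose squared modulus is (a^2 - b^2)^2 + 2 a^2 b^2 (1 -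
    cos(2 pi t)). The proof expands the double angle in terms of c = cos(pi t) and s = sin(pi t). *)
Lemma normc_conjD_hyp_rot (a b t : R) : a ^+ 2 - b ^+ 2 = 1 ->
  Normc.normc ((hyp_rot a b *m conjD t (hyp_rot a (- b))) 0 0) ^+ 2 =
  1 + 4 * b ^+ 2 * a ^+ 2 * sin (pi * t) ^+ 2.
Proof.
move=> ab; rewrite /conjD invmx_Dmx /hyp_rot /Dmx !mulmx22 mxE /=.
rewrite sqr_sqrtr ?addr_ge0 ?sqr_ge0// cosN sinN.
have := cos2Dsin2 (pi * t).
move: (cos _) (sin _) => c s cs.
have a2 : a ^+ 2 = 1 + b ^+ 2 by rewrite -ab subrK.
have c2 : c ^+ 2 = 1 - s ^+ 2 by rewrite -cs addrK.
rewrite [LHS](_ : _ = (a ^+ 2 * (c ^+ 2 + s ^+ 2) -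
    b ^+ 2 * (c ^+ 2 - s ^+ 2)) ^+ 2 + 4 * (b ^+ 2) ^+ 2 * c ^+ 2 * s ^+ 2); last by ring.
by rewrite a2 c2; ring.
Qed.

End matrices.

(** * L^q norms and the violation for small x *)

Section norms.
Local Open Scope classical_set_scope.
Local Open Scope ring_scope.
Variable R : realType.
Implicit Types t x y p q : R.
Local Notation mu := (@lebesgue_measure R).

(** The square root of log |a_1(t)|^2 for b^2 = x and a^2 = 1 + x, by [normc_conjD_hyp_rot]. *)
Definition log_sqrt x : R -> R :=
  fun t => ln (1 + 4 * x * (1 + x) * sin (pi * t) ^+ 2) `^ (2^-1).

Lemma measurable_log_sqrt x : measurable_fun setT (log_sqrt x).
Proof.
apply: (@measurableT_comp _ _ _ _ _ _ (fun y => ln y `^ (2^-1))).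
  apply: (@measurableT_comp _ _ _ _ _ _ (fun y => y `^ (2^-1))).
    exact: measurable_powR.
  exact: measurable_ln.
apply: measurable_funD => //; apply: measurable_funM => //.
apply: measurable_funX; apply: continuous_measurable_fun.
exact: continuous_sin_pi.
Qed.

(** The one-dimensional torus measure is the image of the circle measure times a Dirac mass at the
    empty tuple; Tonelli integrates the Dirac factor out. *)
Lemma Lnorm_haar_torus1 q (h : R -> R) : measurable_fun setT h ->
  ('N[haar_torus R 1]_(q%:E) [(fun t : 1.-tuple R => (h (nth 0%R t 0))%:E)] =
   'N[haar_circle R]_(q%:E) [(fun t : R => (h t)%:E)])%E.
Proof.
move=> mh; rewrite unlock; congr (_ `^ _)%E.
have mg : measurable_fun setT (fun t : R => `|(h t)%:E| `^ q)%E.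
  apply: (measurableT_comp (measurable_poweR q)).
  by apply: measurableT_comp => //; exact/measurable_EFinP.
have mt : measurable_fun setT
    (fun t : 1.-tuple (measurableTypeR R) => `|(h (nth 0%R t 0))%:E| `^ q)%E.
  rewrite (_ : (fun _ => _) = (fun t : R => `|(h t)%:E| `^ q)%E \o
     (fun t : 1.-tuple (measurableTypeR R) => tnth t ord0)); last first.
    by apply/funext => t /=; rewrite (tnth_nth 0%R).
  apply: measurableT_comp => //; exact: measurable_tnth.
rewrite /= ge0_integral_distribution//.
rewrite fubini_tonelli1/=; last 2 first.
  - apply: measurableT_comp => //; exact: measurable_tcons.
  - by move=> z; rewrite lee_fin powR_ge0.
apply: eq_integral => t _; rewrite /fubini_F /= integral_cst//.
by rewrite [X in (_ * X)%E]diracT mule1.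
Qed.

(** This is ln z <= z - 1 at z = 1 / (1 + y). *)
Lemma ln1D_ge y : 0 <= y -> y / (1 + y) <= ln (1 + y).
Proof.
move=> y0; have y1 : 0 < 1 + y by lra.
have : ln (1 + - (y / (1 + y))) <= - (y / (1 + y)).
  by apply: le_ln1Dx; rewrite ltrN2 ltr_pdivrMr//; lra.
have -> : 1 + - (y / (1 + y)) = (1 + y)^-1 by field; rewrite gt_eqF.
by rewrite lnV// lerN2.
Qed.

(** Apply [ln1D_ge] with y = 4 x (1 + x) sin^2(pi t). Since sin^2 <= 1, the denominator 1 + y is at
    most 1 + 4 x (1 + x) = (1 + 2 x)^2. *)
Lemma log_sqrt_powR_ge x q t : 0 <= x -> 0 <= q -> 0 <= t -> t <= 1 ->
  (4 * x / (1 + 2 * x) ^+ 2) `^ (q / 2) * sin (pi * t) `^ q <= log_sqrt x t `^ q.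
Proof.
move=> x0 q0 t0 t1; have s0 := sin_pi_ge0 t0 t1.
rewrite /log_sqrt; have := sin_le1 (pi * t).
move: (sin _) s0 => s s0 s1.
rewrite -powRrM [2^-1 * q]mulrC.
have -> : s `^ q = (s ^+ 2) `^ (q / 2).
  by rewrite -powR_mulrn// -powRrM; congr (_ `^ _); field.
have x20 : 0 < 1 + 2 * x by lra.
have y0 : 0 <= 4 * x * (1 + x) * s ^+ 2.
  by rewrite !mulr_ge0 ?exprn_ge0//; lra.
rewrite -powRM ?divr_ge0 ?mulr_ge0 ?exprn_ge0 ?(ltW x20)//.
rewrite ge0_ler_powR ?nnegrE ?divr_ge0//.
- by rewrite mulr_ge0 ?divr_ge0 ?exprn_ge0 ?mulr_ge0 ?(ltW x20).
- by apply: ln_ge0; rewrite lerDl.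
apply: le_trans (ln1D_ge y0).
have s21 : s ^+ 2 <= 1 by rewrite expr_le1.
move: (s ^+ 2) s21 (sqr_ge0 s) y0 => v v1 v0 y0.
rewrite ler_pdivlMr; last lra.
rewrite mulrAC -mulrA mulrAC ler_pdivrMr ?exprn_gt0//.
rewrite -mulrA -[leRHS]mulrA; rewrite -!mulrA !(ler_wpM2l)//.
nra.
Qed.

Lemma exists_small_parameter (L q : R) : 1 < L -> 0 < q ->
  exists2 x : R, 0 < x & (1 + 2 * x) `^ q < L.
Proof.
move=> L1 q0; have L0 : 0 < L by lra.
(* This x makes (1 + 2 x)^q equal to the square root of L. *)
exists ((L `^ (2^-1 / q) - 1) / 2).
  rewrite divr_gt0 ?subr_gt0// -[ltLHS](powRr0 L) /powR gt_eqF// ltr_expR.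
  by rewrite ltr_pM2r ?ln_gt0// divr_gt0.
have -> : 1 + 2 * ((L `^ (2^-1 / q) - 1) / 2) = L `^ (2^-1 / q) by field.
rewrite -powRrM mulfVK ?gt_eqF// -[ltRHS](powRr1 (ltW L0)) /powR gt_eqF// ltr_expR.
by rewrite ltr_pM2r ?ln_gt0//; lra.
Qed.

Lemma powR2_lt_central_binom p q : 1 < p -> 2 < q ->
  p^-1 < q^-1 * log2 (central_binom q) -> 2 `^ (q / p) < central_binom q.
Proof.
move=> p1 q2; have q0 : 0 < q by lra.
have c0 := central_binom_gt0 (ltW q0).
have l2 : 0 < ln 2 :> R by rewrite ln_gt0//; lra.
rewrite ltr_pdivlMl// /log2 ltr_pdivlMr// => h.
by rewrite -ltr_ln ?posrE ?powR_gt0// ln_powR.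
Qed.

(** Compare q-th powers. The right side is at most 2^(q/p) x^(q/2) by ln(1 + x) <= x, and the left
    side is at least 2^q x^(q/2) / (1 + 2 x)^q times the sine moment. The powers of x cancel,
    leaving (1 + 2 x)^q < L with L = 2^q [sin_moment q] / 2^(q/p) > 1. *)
Lemma log_sqrt_violation p q : 1 < p -> p < 2 -> 2 < q ->
  p^-1 < q^-1 * log2 (central_binom q) ->
  exists2 x : R, 0 < x &
    ((((ln (1 + x)) `^ (p / 2) *+ 2) `^ p^-1)%:E <
     'N[haar_circle R]_(q%:E) [(fun t => (log_sqrt x t)%:E)])%E.
Proof.
move=> p1 p2 q2 hpq.
have q0 : 0 < q by lra.
have p0 : 0 < p by lra.
have hcb := powR2_lt_central_binom p1 q2 hpq.
have W := lt_le_trans hcb (central_binom_le_sin_moment q0).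
have c0 : 0 < 2 `^ (q / p) :> R by exact: powR_gt0.
have [|x x0 xL] := @exists_small_parameter (2 `^ q * sin_moment q / 2 `^ (q / p)) q _ q0.
  by rewrite ltr_pdivlMr// mul1r.
exists x => //.
rewrite ltNge; apply/negP => le.
have : ('N[haar_circle R]_(q%:E) [(fun t => (log_sqrt x t)%:E)] `^ q <=
        (((ln (1 + x) `^ (p / 2) *+ 2) `^ p^-1)%:E) `^ q)%E.
  apply: (gt0_ler_poweR (ltW q0)) => //;
    by rewrite in_itv/= leey andbT ?Lnorm_ge0 ?lee_fin ?powR_ge0.
rewrite poweR_Lnorm ?gt_eqF// poweR_EFin -powRrM.
have x20 : 0 < 1 + 2 * x by lra.
have v0 : 0 <= ln (1 + x) by apply: ln_ge0; lra.
have vx : ln (1 + x) <= x by apply: le_ln1Dx; lra.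
have -> : (ln (1 + x) `^ (p / 2) *+ 2) `^ (p^-1 * q) =
          2 `^ (q / p) * ln (1 + x) `^ (q / 2).
  rewrite -mulr_natl powRM ?powR_ge0// [p^-1 * q]mulrC; congr (_ * _).
  by rewrite -powRrM; congr (_ `^ _); field; rewrite gt_eqF.
have ms := measurable_log_sqrt x.
have mg : measurable_fun setT (fun t : R => (log_sqrt x t `^ q)%:E).
  apply/measurable_EFinP; exact: (measurableT_comp (measurable_powR _)).
rewrite (_ : (fun _ => _) = (fun t => (log_sqrt x t `^ q)%:E)); last first.
  by apply/funext => t; rewrite /= ger0_norm ?powR_ge0.
rewrite integral_uniform//; last by move=> t; rewrite lee_fin powR_ge0.
rewrite subr0 invr1 mul1e; apply/negP; rewrite -ltNge.
pose c := 4 * x / (1 + 2 * x) ^+ 2.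
(* The middle term is the integral of the pointwise lower bound in [log_sqrt_powR_ge]. *)
apply: (@lt_le_trans _ _ ((c `^ (q / 2) * sin_moment q)%:E)).
  rewrite lte_fin.
  have cE : c `^ (q / 2) = 2 `^ q * x `^ (q / 2) / (1 + 2 * x) `^ q.
    rewrite /c powRM ?mulr_ge0 ?invr_ge0 ?exprn_ge0 ?(ltW x0) ?(ltW x20)//.
    rewrite powRM ?(ltW x0)//.
    have -> : ((1 + 2 * x) ^+ 2)^-1 `^ (q / 2) = ((1 + 2 * x) `^ q)^-1.
      rewrite -[X in X `^ _]powR_inv1 ?exprn_ge0 ?(ltW x20)//.
      rewrite -powR_mulrn ?(ltW x20)// -!powRrM -powRN.
      by congr (_ `^ _); field.
    have -> : 4 `^ (q / 2) = 2 `^ q :> R.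
      have -> : 4 = 2 ^+ 2 :> R by ring.
      by rewrite -powR_mulrn// -powRrM; congr (_ `^ _); field.
    by [].
  rewrite cE.
  apply: (@le_lt_trans _ _ (2 `^ (q / p) * x `^ (q / 2))).
    rewrite ler_wpM2l ?(ltW c0)// ge0_ler_powR ?nnegrE ?(ltW x0)//.
    by rewrite divr_ge0// ltW.
  rewrite mulrAC ltr_pdivlMr ?powR_gt0//.
  rewrite -mulrA [x `^ _ * _]mulrC mulrA [ltRHS]mulrAC ltr_pM2r ?powR_gt0//.
  by rewrite mulrC -ltr_pdivlMr.
have iS := integrable_sin_powR (ltW q0).
rewrite /sin_moment -RintegralZl// /Rintegral fineK; last first.
  by apply: integrable_fin_num => //; exact: integrable_EFinZl.
apply: ge0_le_integral => //.
- by move=> t /=; rewrite in_itv/= => /andP[t0 t1]; rewrite lee_fin mulr_ge0 ?powR_ge0.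
- apply/measurable_EFinP/measurable_funTS/measurable_funM => //.
  apply: (measurableT_comp (measurable_powR _)).
  by apply: continuous_measurable_fun; exact: continuous_sin_pi.
- exact: measurable_funTS.
- move=> t /=; rewrite in_itv/= => /andP[t0 t1]; rewrite lee_fin.
  exact: (log_sqrt_powR_ge (ltW x0) (ltW q0) t0 t1).
Qed.

End norms.

(** * Counterexamples for two factors and for the tree of depth one *)

Theorem mainTheorem3 (R : realType) (p q : R)
    (p_gt1 : 1 < p) (p_lt2 : p < 2) (q_gt2 : 2 < q)
    (hpq : p^-1 < q^-1 * log2 (central_binom q)) :
  (exists (d : nat) (G : seq bool -> 'M[R[i]]_2),
     [/\ (1 <= d)%N,
         forall w : d.-tuple bool, SU11 (G w) &
         ~ ('N[haar_torus R d]_(q%:E) [(fun t : d.-tuple R =>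
                ((ln (Normc.normc (rootmx G t 0 0) ^+ 2)) `^ (2^-1))%:E)]
            <= ((\sum_(w : d.-tuple bool)
                   (ln (Normc.normc (G w 0 0) ^+ 2)) `^ (p / 2)) `^ p^-1)%:E)%E])
  /\
  (exists G0 G1 : 'M[R[i]]_2,
     [/\ SU11 G0, SU11 G1 &
         ~ ('N[haar_circle R]_(q%:E) [(fun t : R =>
                ((ln (Normc.normc ((G0 *m conjD t G1) 0 0) ^+ 2)) `^ (2^-1))%:E)]
            <= (((ln (Normc.normc (G0 0 0) ^+ 2)) `^ (p / 2)
                 + (ln (Normc.normc (G1 0 0) ^+ 2)) `^ (p / 2)) `^ p^-1)%:E)%E]).
Proof.
have [x x0 viol] := log_sqrt_violation p_gt1 p_lt2 q_gt2 hpq.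
set N := Lnorm _ _ _ in viol.
pose a := Num.sqrt (1 + x); pose b := Num.sqrt x.
have a2 : a ^+ 2 = 1 + x by rewrite sqr_sqrtr// addr_ge0// ltW.
have b2 : b ^+ 2 = x by rewrite sqr_sqrtr// ltW.
have ab : a ^+ 2 - b ^+ 2 = 1 by rewrite a2 b2 addrK.
have abN : a ^+ 2 - (- b) ^+ 2 = 1 by rewrite sqrrN.
have rootE t : ln (Normc.normc ((hyp_rot a b *m conjD t (hyp_rot a (- b))) 0 0) ^+ 2)
    `^ 2^-1 = log_sqrt x t.
  by rewrite normc_conjD_hyp_rot// a2 b2.
split; last first.
  exists (hyp_rot a b), (hyp_rot a (- b)); split; [exact: SU11_hyp_rot..|].
  apply/negP; rewrite -ltNge !normc_hyp_rot a2 -mulr2n.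
  by under eq_Lnorm do rewrite rootE.
(* At depth one a word is a single letter, which selects the factor. The root matrix then reduces by
   computation to the product used for two factors, so [rootE] applies to it. *)
pose G (w : seq bool) := if head false w then hyp_rot a (- b) else hyp_rot a b.
have normG w : Normc.normc (G w 0 0) ^+ 2 = 1 + x.
  by rewrite /G; case: ifP => _; rewrite normc_hyp_rot.
exists 1%N, G; split => //.
  by move=> w; rewrite /G; case: ifP => _; exact: SU11_hyp_rot.
apply/negP; rewrite -ltNge.
under eq_bigr do rewrite normG.
rewrite sumr_const card_tuple card_bool expn1.
have rootGE (t : 1.-tuple R) :
    ln (Normc.normc (rootmx G t 0 0) ^+ 2) `^ 2^-1 = log_sqrt x (nth 0 t 0).
  exact: rootE.
under eq_Lnorm do rewrite rootGE.
by rewrite Lnorm_haar_torus1//; exact: measurable_log_sqrt.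
Qed.
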